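(* Let $\{\theta_t\}_{t\in\mathbb{Z}}$ be a persistent function on a persistence group $\mathcal{G}:(\mathbb{Z},\leq)\to\mathbf{Grp}$. For any $s\leq t$, let $K=\ker(\phi_{s,t})$ be the kernel of the group homomorphism $\phi_{s,t}:\mathcal{G}_s\to\mathcal{G}_t$. Then for any $g_s\in\mathcal{G}_s$, the value $\theta_s(g_s)$ can be recovered via the formula $$\theta_s(g_s)=\frac{1}{|\mathcal{G}_s|}\sum_{\varrho_s\in\widehat{(\mathcal{G}_s)}_K}d_{\varrho_s}\cdot\mathrm{tr}\big(\widehat\theta_{s,t}(\varrho_s)\cdot\varrho_{s,t}(g_s)\big),$$ where $\widehat{(\mathcal{G}_s)}_K$ denotes the set of inequivalent irreducible representations of $\mathcal{G}_s$ that are trivial on $K$.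
   Context: A persistence group is a functor $\mathcal{G}:(\mathbb{Z},\leq)\to\mathbf{Grp}$ with finite groups $\mathcal{G}_t$ and structure homomorphisms $\phi_{s,t}:\mathcal{G}_s\to\mathcal{G}_t$. A persistent function on $\mathcal{G}$ is a family of functions $\theta_t:\mathcal{G}_t\to\mathbb{C}$, $t\in\mathbb{Z}$, with $\theta_s=\theta_t\circ\phi_{s,t}$ for all $s\leq t$. Representations are complex; $\widehat{\mathcal{G}}_s$ is the set of equivalence classes of irreducible representations of $\mathcal{G}_s$ and $d_{\varrho}$ is the dimension of $\varrho$. Let $\rho_t$ be the left regular representation of $\mathcal{G}_t$ on $\mathbb{C}[\mathcal{G}_t]$ and let $f_{s,t}:\mathbb{C}[\mathcal{G}_s]\to\mathbb{C}[\mathcal{G}_t]$ be the linear extension of $\phi_{s,t}$. Realize an irreducible $\varrho_s\in\widehat{\mathcal{G}}_s$ as a subrepresentation $W_s\subseteq\mathbb{C}[\mathcal{G}_s]$ of the regular representation. The persistent representation $\varrho_{s,t}$ of $\varrho_s$ is the representation of $\mathcal{G}_s$ on $W_{s,t}=f_{s,t}(W_s)\subseteq\mathbb{C}[\mathcal{G}_t]$ given by $\varrho_{s,t}(g)(v)=\rho_t(\phi_{s,t}(g))(v)$. The $(s,t)$-persistent Fourier transform is $$\widehat\theta_{s,t}(\varrho_s)=\sum_{g_s\in\mathcal{G}_s}\theta_s(g_s)\,\varrho_{s,t}(g_s^{-1})\in\mathrm{End}(W_{s,t}).$$ *)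

(* Defs.v *)
From HB Require Import structures.
From mathcomp Require Import all_boot all_order all_algebra all_fingroup.
From mathcomp Require Import all_solvable all_field all_character.
From mathcomp Require Import reals complex.
Set Implicit Arguments.
Unset Strict Implicit.
Unset Printing Implicit Defensive.
Import Order.TTheory GRing.Theory Num.Theory.
Local Open Scope ring_scope.

(* The order on int is Boolean, so a proof of s <= t carries no data. *)
Record persistence_group := PersistenceGroup {
  pgroup_at :> int -> finGroupType;
  pgroup_map : forall s t : int, s <= t ->
    {morphism [set: pgroup_at s] >-> pgroup_at t};
  pgroup_map_id : forall (s : int) (ss : s <= s) x, pgroup_map ss x = x;
  pgroup_map_comp :
    forall (r s t : int) (rs : r <= s) (st : s <= t) (rt : r <= t) x,
      pgroup_map rt x = pgroup_map st (pgroup_map rs x)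
}.

Definition persistent_function (T : Type) (G : persistence_group)
    (theta : forall t : int, G t -> T) : Prop :=
  forall (s t : int) (st : s <= t) (x : G s),
    theta s x = theta t (pgroup_map G st x).

(* F[gT] is the space of functions gT -> F, with the indicator functions of   *)
(* the group elements as its canonical basis.                                 *)
Definition group_alg (F : fieldType) (gT : finGroupType) : vectType F :=
  {ffun gT -> F^o}.

Definition galg_elt (F : fieldType) (gT : finGroupType) (x : gT) :
  group_alg F gT := [ffun y => (y == x)%:R].

Section LinearExtension.
Variables (F : fieldType) (gT hT : finGroupType) (f : gT -> hT).

Definition galg_ext_fun (v : group_alg F gT) : group_alg F hT :=
  \sum_(x : gT) (v : {ffun gT -> F^o}) x *: galg_elt F (f x).

Fact galg_ext_fun_linear : linear galg_ext_fun.
Proof.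
move=> a u v; rewrite /galg_ext_fun scaler_sumr -big_split /=.
by apply: eq_bigr => x _; rewrite !ffunE scalerDl scalerA.
Qed.

HB.instance Definition _ := GRing.isLinear.Build F _ _ _ galg_ext_fun
  galg_ext_fun_linear.

Definition galg_ext : 'Hom(group_alg F gT, group_alg F hT) :=
  linfun galg_ext_fun.

Lemma galg_ext_elt (x : gT) : galg_ext (galg_elt F x) = galg_elt F (f x).
Proof.
rewrite lfunE /= /galg_ext_fun (bigD1 x) //= ffunE eqxx scale1r.
by rewrite big1 ?addr0 // => y /negPf yx; rewrite ffunE yx scale0r.
Qed.

End LinearExtension.

Definition left_regular (F : fieldType) (gT : finGroupType) (g : gT) :
  'End(group_alg F gT) := galg_ext F (fun x : gT => (g * x)%g).

(* W is a subrepresentation of the left regular representation isomorphic to  *)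
(* rG.  Matrices act on column vectors, for which repr_mxM (which asserts     *)
(* that rG (x * y) = rG x *m rG y) is the law of a left action.               *)
Definition realizes (F : fieldType) (gT : finGroupType) (n : nat)
    (rG : mx_representation F [set: gT] n) (W : {vspace group_alg F gT}) :
    Prop :=
  exists f : 'Hom('cV[F]_n, group_alg F gT),
    [/\ lker f == 0%VS, limg f = W
      & forall (g : gT) (v : 'cV[F]_n), f (rG g *m v) = left_regular F g (f v)].

Section PersistentRepresentation.
Variables (F : fieldType) (gT hT : finGroupType).
Variable phi : {morphism [set: gT] >-> hT}.
Variable W : {vspace group_alg F gT}.

Definition persistent_space : {vspace group_alg F hT} :=
  (galg_ext F phi @: W)%VS.

(* vsproj only casts back into persistent_space, which is stable under the    *)
(* action when W is: see persistent_reprE.                                    *)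
Definition persistent_repr (g : gT) : 'End(subvs_of persistent_space) :=
  linfun (vsproj persistent_space \o left_regular F (phi g) \o vsval).

Definition persistent_fourier (theta : gT -> F) :
  'End(subvs_of persistent_space) :=
  \sum_(g : gT) theta g *: persistent_repr g^-1%g.

End PersistentRepresentation.

Definition lfun_trace (F : fieldType) (V : vectType F) (f : 'End(V)) : F :=
  \tr (passmx.mxof (vbasis {:V}) (vbasis {:V}) f).

Section Facts.
Variables (F : fieldType) (gT hT : finGroupType).
Variable phi : {morphism [set: gT] >-> hT}.

Lemma galg_span (v : group_alg F gT) :
  v = \sum_(x : gT) (v : {ffun gT -> F^o}) x *: galg_elt F x.
Proof.
apply/ffunP => y; rewrite sum_ffunE (bigD1 y) //= big1 => [|x /negPf xy].
  by rewrite !ffunE eqxx addr0 /GRing.scale /= mulr1.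
by rewrite !ffunE eq_sym xy scaler0.
Qed.

Lemma galg_ext_regular (g : gT) (v : group_alg F gT) :
  galg_ext F phi (left_regular F g v) =
  left_regular F (phi g) (galg_ext F phi v).
Proof.
rewrite (galg_span v) !linear_sum; apply: eq_bigr => x _.
by rewrite !linearZ /= !galg_ext_elt morphM ?inE.
Qed.

Lemma persistent_reprE n (rG : mx_representation F [set: gT] n)
    (W : {vspace group_alg F gT}) (g : gT)
    (v : subvs_of (persistent_space phi W)) :
  realizes rG W ->
  vsval (persistent_repr phi W g v) = left_regular F (phi g) (vsval v).
Proof.
case=> f [_ fW fJ]; rewrite lfunE /= vsprojK //.
have /memv_imgP[w Ww ->] := subvsP v.
rewrite -galg_ext_regular memv_img //; move: Ww; rewrite -fW.
by case/memv_imgP => u _ ->; rewrite -fJ memv_img ?memvf.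
Qed.

Lemma irr_realizable n (rG : mx_representation F [set: gT] n) :
  mx_irreducible rG -> exists W, realizes rG W.
Proof.
case/mx_irrP; case: n rG => // n rG _ irrG.
pose l : 'rV[F]_n.+1 := delta_mx 0 0.
pose h (v : 'cV[F]_n.+1) : group_alg F gT :=
  [ffun x => (l *m rG x^-1%g *m v) 0 0 : F^o].
have h_lin : linear h.
  by move=> a u v; apply/ffunP => x; rewrite !ffunE mulmxDr -scalemxAr !mxE.
pose hL := GRing.isLinear.Build F _ _ _ h h_lin.
pose hl : {linear _ -> _} := HB.pack h hL.
have hE v : linfun hl v = h v by rewrite lfunE.
exists (limg (linfun hl)), (linfun hl); split=> //.
  apply/lker0P => u v; rewrite !hE => /eqP.
  rewrite -subr_eq0 -[h u - h v](linearB hl) => /eqP h0.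
  apply/eqP; rewrite -subr_eq0; apply/eqP; move: (u - v) h0 => {u}v h0.
  pose U := cyclic_mx rG l.
  have Umod : mxmodule rG U := cyclic_mx_module rG l.
  have U0 : U != 0.
    apply/eqP => U0; have := cyclic_mx_id rG l; rewrite -/U U0 submx0.
    by move=> /eqP/matrixP/(_ 0 0)/eqP; rewrite !mxE !eqxx oner_eq0.
  have Uv : U *m v = 0.
    apply/row_matrixP => i; rewrite row_mul row0.
    have /cyclic_mxP[A /envelop_mxP[a ->] ->] := row_sub i U.
    rewrite mulmx_sumr mulmx_suml big1 // => x _.
    rewrite -scalemxAr -scalemxAl; apply/matrixP => j k; rewrite !ord1 mxE.
    by move/ffunP/(_ x^-1%g): h0; rewrite !ffunE invgK => ->; rewrite mulr0 mxE.
  have Ufull : U \in unitmx by rewrite -row_full_unit irrG.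
  by rewrite -(mulKmx Ufull v) Uv mulmx0.
move=> g v; rewrite !hE /left_regular lfunE /= /galg_ext_fun.
apply/ffunP => x; rewrite sum_ffunE (bigD1 (g^-1 * x)%g) //= big1 => [|y yx].
  rewrite !ffunE mulKVg eqxx /GRing.scale /= mulr1 addr0.
  by rewrite invMg invgK repr_mxM ?inE // !mulmxA.
rewrite !ffunE; case: eqP => [xE|_]; last by rewrite scaler0.
by rewrite xE mulKg eqxx in yx.
Qed.

End Facts.

(* Main.v *)
Require Import Defs.
From HB Require Import structures.
From mathcomp Require Import all_boot all_order all_algebra all_fingroup.
From mathcomp Require Import all_solvable all_field all_character.
From mathcomp Require Import reals complex.
Set Implicit Arguments.
Unset Strict Implicit.
Unset Printing Implicit Defensive.
Import Order.TTheory GRing.Theory Num.Theory.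
Import passmx.
Local Open Scope ring_scope.

(** The formula is classical Fourier inversion on [G s] with the vanishing
    terms removed and the remaining ones transported to [G t].

    Write K for the kernel of [phi : G s -> G t].  Persistence makes [theta s]
    factor through [phi], so it is constant on the cosets of K.  Hence its
    Fourier coefficient at an irreducible representation rG, the matrix
    sum_g theta(g) rG(g^-1), is unchanged when multiplied by rG(k) for k in K:
    its rows are K-fixed.  As K is normal, the K-fixed vectors form a
    subrepresentation, so either K acts trivially or the coefficient is zero
    ([fourier_vanish]).  Inversion over all irreducible representations
    ([fourier_inversion], from the decomposition of the regular character)
    therefore only involves those that are trivial on K.

    For these, pushing W forward along [phi] loses nothing: a K-invariant
    function w on [G s] is pushed to a function whose value at [phi x] is
    |K| w(x), and |K| is invertible.  So W_{s,t} is isomorphic to the original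
    irreducible representation ([persistent_repr_equiv]), and the trace of the
    persistent transform equals the trace of the matrix coefficient
    ([lfun_trace_persistent_fourier]). *)

(** The trace of an endomorphism is defined from a chosen basis of V, whose
    length need not be syntactically n; a pair of mutually inverse rectangular
    matrices avoids casting one dimension to the other. *)
Lemma lfun_trace_intertwine (F : fieldType) (n : nat) (V : vectType F)
    (f : 'Hom('cV[F]_n, V)) (A : 'M[F]_n) (E : 'End(V)) :
  lker f == 0%VS -> limg f = fullv ->
  (forall v, E (f v) = f (A *m v)) -> lfun_trace E = \tr A.
Proof.
move=> f_inj f_surj fE; rewrite /lfun_trace; set e := vbasis _.
have e_basis : basis_of fullv e := vbasisP _.
pose X := lin1_mx (rVof e \o f \o trmx).
pose Y := lin1_mx (trmx \o (f^-1)%VF \o vecof e).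
have XE u : u *m X = rVof e (f u^T) by rewrite /X mul_rV_lin1.
have YE u : u *m Y = ((f^-1)%VF (vecof e u))^T by rewrite /Y mul_rV_lin1.
have XY : X *m Y = 1%:M.
  apply/row_matrixP => i; rewrite row_mul [in LHS]rowE XE YE.
  by rewrite rVofK // lker0_lfunK // trmxK row1.
have YX : Y *m X = 1%:M.
  apply/row_matrixP => i; rewrite row_mul [in LHS]rowE YE XE trmxK.
  by rewrite limg_lfunVK ?f_surj ?memvf // vecofK // row1.
(* mxof acts on row vectors and A on column vectors, whence the transpose. *)
have XE_AX : X *m mxof e e E = A^T *m X.
  apply/row_matrixP => i; rewrite !row_mul !rowE XE mul_mxof.
  by rewrite rVofK // fE XE !trmx_mul !trmxK.
by rewrite -(mulmx1 (mxof _ _ _)) -YX mulmxA mxtrace_mulC mulmxA XE_AX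
  -mulmxA XY mulmx1 mxtrace_tr.
Qed.

Lemma left_regularE (F : fieldType) (gT : finGroupType) (g x : gT)
    (w : group_alg F gT) :
  (left_regular F g w : {ffun gT -> F^o}) x =
  (w : {ffun gT -> F^o}) (g^-1 * x)%g.
Proof.
rewrite lfunE /= /galg_ext_fun sum_ffunE (bigD1 (g^-1 * x)%g) //= big1 ?addr0.
  by rewrite !ffunE mulKVg eqxx /GRing.scale /= mulr1.
move=> y /negPf yx; rewrite !ffunE eq_sym (can2_eq (mulKg g) (mulKVg g)).
by rewrite yx scaler0.
Qed.

Lemma galg_extE (F : fieldType) (gT hT : finGroupType) (f : gT -> hT) (z : hT)
    (w : group_alg F gT) :
  (galg_ext F f w : {ffun hT -> F^o}) z =
  \sum_(x : gT | f x == z) (w : {ffun gT -> F^o}) x.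
Proof.
rewrite lfunE /= /galg_ext_fun sum_ffunE [RHS]big_mkcond; apply: eq_bigr => x _.
rewrite !ffunE eq_sym; case: eqP => _; last by rewrite scaler0.
by rewrite /GRing.scale /= mulr1.
Qed.

Section PersistentOfTrivialOnKernel.

Variables (F : fieldType) (gT hT : finGroupType).
Variable phi : {morphism [set: gT] >-> hT}.
Variables (n : nat) (rG : mx_representation F [set: gT] n).
Hypothesis K_unit : #|('ker phi)%g|%:R != 0 :> F.

(** The fibre of [phi] over [phi x] is the coset of the kernel through x, on
    which an invariant w is constant. *)
Lemma galg_ext_kernel_invariant (w : group_alg F gT) (x : gT) :
    (forall k, k \in ('ker phi)%g -> left_regular F k w = w) ->
  (galg_ext F phi w : {ffun hT -> F^o}) (phi x) =
  #|('ker phi)%g|%:R * (w : {ffun gT -> F^o}) x.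
Proof.
move=> Kw; rewrite galg_extE.
rewrite (reindex (fun k => k * x)%g) /=; last first.
  by exists (fun y => y * x^-1)%g => y _; rewrite ?mulgK ?mulgKV.
rewrite (eq_bigl (mem ('ker phi)%g)) => [|k]; last first.
  by rewrite -[RHS]/(k \in _) 2!inE /= inE morphM ?inE // eq_mulgV1 mulgK.
rewrite (eq_bigr (fun=> (w : {ffun gT -> F^o}) x)) => [|k Kk].
  by rewrite sumr_const mulr_natl.
by rewrite -{2}(Kw k^-1%g) ?groupV // left_regularE invgK.
Qed.

(** Triviality of rG on the kernel makes every element of W invariant, so the
    pushforward can be undone pointwise on W by dividing by the order of the
    kernel. *)
Lemma persistent_repr_equiv (W : {vspace group_alg F gT}) :
    realizes rG W -> ('ker phi)%g \subset rker rG ->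
  exists f : 'Hom('cV[F]_n, subvs_of (persistent_space phi W)),
    [/\ lker f == 0%VS, limg f = fullv
      & forall g v, persistent_repr phi W g (f v) = f (rG g *m v)].
Proof.
move=> realW Ktriv; have [h [h_inj hW hJ]] := realW.
pose f := linfun (vsproj (persistent_space phi W) \o galg_ext F phi \o h).
have fE v : vsval (f v) = galg_ext F phi (h v).
  by rewrite lfunE /= vsprojK // memv_img // -hW memv_img ?memvf.
exists f; split.
- apply/lker0P => u v /(congr1 vsval); rewrite !fE => fhuv.
  have Kh a k : k \in ('ker phi)%g -> left_regular F k (h a) = h a.
    by move=> /(subsetP Ktriv)/rkerP[_ rGk]; rewrite -hJ rGk mul1mx.
  apply: (lker0P h_inj); apply/ffunP => x; apply: (mulfI K_unit).
  by rewrite -!galg_ext_kernel_invariant ?fhuv //; apply: Kh.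
- apply/eqP; rewrite eqEsubv subvf; apply/subvP => w _.
  have /memv_imgP[u Wu wE] := subvsP w.
  have /memv_imgP[v _ uE] : u \in limg h by rewrite hW.
  apply/memv_imgP; exists v; rewrite ?memvf //.
  by apply/val_inj; rewrite /= fE -uE.
- move=> g v; apply/val_inj; rewrite /= (persistent_reprE _ _ realW) !fE.
  by rewrite -galg_ext_regular hJ.
Qed.

Lemma lfun_trace_persistent_fourier (W : {vspace group_alg F gT})
    (theta : gT -> F) (x : gT) :
    realizes rG W -> ('ker phi)%g \subset rker rG ->
  lfun_trace (persistent_fourier phi W theta \o persistent_repr phi W x)%VF =
  \tr ((\sum_g theta g *: rG g^-1%g) *m rG x).
Proof.
move=> realW /(persistent_repr_equiv realW)[f [f_inj f_surj fJ]].
apply: (lfun_trace_intertwine f_inj f_surj) => v.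
rewrite comp_lfunE fJ /persistent_fourier sum_lfunE -mulmxA mulmx_suml linear_sum.
by apply: eq_bigr => g _; rewrite scale_lfunE fJ -scalemxAl linearZ.
Qed.

End PersistentOfTrivialOnKernel.

Lemma mxtrace_regular_repr (F : fieldType) (gT : finGroupType)
    (G : {group gT}) (x : gT) : x \in G ->
  \tr (regular_repr F G x) = #|G|%:R *+ (x == 1%g).
Proof.
move=> Gx; have [-> | ntx] := eqVneq x 1%g; first by rewrite repr_mx1 mxtrace1.
rewrite [LHS]big1 // => i _; rewrite 2!mxE /=.
rewrite -(inj_eq enum_val_inj) gring_indexK ?groupM ?enum_valP //.
by rewrite eq_mulVg1 mulKg (negbTE ntx).
Qed.

(** By linearity this reduces to the case of an indicator function, where it
    says that the sum of the irreducible characters weighted by their degrees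
    is the regular character, i.e. #|gT| times the indicator of 1. *)
Lemma fourier_inversion (F : fieldType) (gT : finGroupType)
    (sG : irrType F [set: gT]) (theta : gT -> F) (x : gT) :
    ([pchar F]^'.-group [set: gT])%g -> group_splitting_field F [set: gT] ->
  \sum_(i : sG) (irr_degree i)%:R *
     \tr ((\sum_g theta g *: irr_repr i g^-1%g) *m irr_repr i x) =
  #|gT|%:R * theta x.
Proof.
move=> F'G splitG.
transitivity (\sum_g theta g * \tr (regular_repr F [set: gT] (g^-1 * x)%g)).
  under [RHS]eq_bigr => g _ do
    rewrite (mxtrace_regular_pchar sG) ?inE // mulr_sumr.
  rewrite exchange_big; apply: eq_bigr => i _.
  rewrite mulmx_suml raddf_sum mulr_sumr; apply: eq_bigr => g _ /=.
  rewrite -scalemxAl mxtraceZ -repr_mxM ?inE // mulrCA.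
  by rewrite [X in _ * X = _]mulr_natl.
rewrite (bigD1 x) //= big1 => [|g /negPf gx].
  by rewrite mxtrace_regular_repr ?inE // mulVg eqxx addr0 cardsT mulrC.
by rewrite mxtrace_regular_repr ?inE // -eq_mulVg1 gx mulr0.
Qed.

(** Translating the summation variable by K shows that the rows of the sum lie
    in the subspace fixed by K, which is a submodule because K is normal. If it
    is nonzero then it is everything, by irreducibility. *)
Lemma fourier_vanish (F : fieldType) (gT : finGroupType) (n : nat)
    (rG : mx_representation F [set: gT] n) (K : {set gT}) (theta : gT -> F) :
    mx_irreducible rG -> (K <| [set: gT])%g ->
    (forall k g, k \in K -> theta (k * g)%g = theta g) ->
    ~~ (K \subset rker rG) ->
  \sum_g theta g *: rG g^-1%g = 0.
Proof.
move=> /mx_irrP[_ irrG] nKG Ktheta; apply: contraNeq => nzS.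
set S := (X in X != 0) in nzS.
have Sfix : (S <= rfix_mx rG K)%MS.
  apply/rfix_mxP => k Kk; rewrite mulmx_suml /S.
  rewrite [RHS](reindex_inj (mulgI k^-1%g)) /=; apply: eq_bigr => g _.
  rewrite -scalemxAl -repr_mxM ?inE // invMg invgK; congr (_ *: _).
  by rewrite -[in LHS](mulKVg k g) Ktheta.
rewrite [rker _]/rker rfix_mx_rstabC ?normal_sub //.
apply: submx_full; apply: irrG; first exact: normal_rfix_mx_module.
by apply: contraNneq nzS => fix0; rewrite -submx0 -fix0.
Qed.

Theorem theorem3p2p4 (R : realType) (G : persistence_group)
    (theta : forall t : int, G t -> R[i])
    (theta_pers : persistent_function theta)
    (s t : int) (st : s <= t)
    (sG : irrType R[i] [set: G s])
    (W : sG -> {vspace group_alg R[i] (G s)})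
    (W_real : forall i : sG, realizes (irr_repr i) (W i))
    (gs : G s) :
  theta s gs =
    (#|G s|%:R)^-1 *
    \sum_(i : sG | ('ker (pgroup_map G st))%g \subset rker (irr_repr i))
      (irr_degree i)%:R *
      lfun_trace (persistent_fourier (pgroup_map G st) (W i) (theta s) \o
                  persistent_repr (pgroup_map G st) (W i) gs)%VF.
Proof.
set phi := pgroup_map G st.
have card_neq0 (H : {group G s}) : #|H|%:R != 0 :> R[i].
  by rewrite pnatr_eq0 -lt0n cardG_gt0.
have F'G : ([pchar R[i]]^'.-group [set: G s])%g.
  by rewrite /pgroup -natf_neq0_pchar card_neq0.
have splitG : group_splitting_field R[i] [set: G s].
  by move=> n rG; exact: group_closure_closed_field.
have G_neq0 : #|G s|%:R != 0 :> R[i] by rewrite -cardsT card_neq0.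
have Ktheta k g : k \in ('ker phi)%g -> theta s (k * g)%g = theta s g.
  move=> Kk; rewrite !(theta_pers s t st) morphM ?inE //.
  by rewrite (mker Kk) mul1g.
apply: (mulfI G_neq0); rewrite mulVKf //.
rewrite -(fourier_inversion sG (theta s) gs F'G splitG).
rewrite [RHS]big_mkcond; apply: eq_bigr => i _; case: ifP => [Ki | /negbT nKi].
  by rewrite (lfun_trace_persistent_fourier (card_neq0 _) _ _ (W_real i) Ki).
rewrite (fourier_vanish (socle_irr i) (ker_normal phi) Ktheta nKi).
by rewrite mul0mx mxtrace0 mulr0.
Qed.
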